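(* (i) For every $1\leq p\leq2$ there is a constant $C>0$ such that $\|A_n\|_{\mathcal{L}(\exp(L_p))}\leq C\sqrt{n}$ for all $n\ge1$. (ii) For every $2\leq p\leq\infty$ there is a constant $C>0$ such that $\|A_n\|_{\mathcal{L}(\exp(L_p))}\leq C\cdot n^{1-1/p}$ for all $n\ge1$.
   Context: For $1\le p<\infty$ let $N_p(u)=e^{u^p}-1$; $\exp(L_p)$ is the Orlicz space on $[0,1]$ (Lebesgue measure) of $x\in L_1[0,1]$ with $\|x\|=\inf\{\lambda>0:\int_0^1N_p(|x(t)|/\lambda)\,dt\le1\}<\infty$. It coincides, up to equivalence of norms, with the Marcinkiewicz space $M(\psi_p)$, $\psi_p(t)=t\log^{1/p}(e/t)$, whose norm is $\sup_{0<\tau\le1}\frac1{\psi_p(\tau)}\int_0^\tau x^*(t)\,dt$. For $p=\infty$, $\exp(L_\infty)$ means $L_\infty[0,1]$ and $1/p=0$. Here $x^*$ is the non-increasing rearrangement of $|x|$; for a probability space $\Omega$, $E(\Omega)$ is the space of $f\in L_1(\Omega)$ with $f^*\in E$, normed by $\|f^*\|_E$. Operators $A_n$: let $r$ be a centered Bernoulli random variable on $[0,1]$ (values $\pm1$, each with probability $\frac12$). For $f\in E$, $A_nf$ is the function on $[0,1]^{2n}$ given by $(A_nf)(s_1,t_1,\dots,s_n,t_n)=\sum_{k=1}^nf(s_k)r(t_k)$; $\|A_n\|_{\mathcal L(E)}$ is the norm of $A_n$ as an operator $E([0,1])\to E([0,1]^{2n})$. *)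

(* Defs.v *)
From HB Require Import structures.
From mathcomp Require Import all_boot all_order all_algebra.
From mathcomp Require Import all_classical all_reals all_analysis.

Set Implicit Arguments.
Unset Strict Implicit.
Unset Printing Implicit Defensive.

Import Order.TTheory GRing.Theory Num.Theory.
Import numFieldNormedType.Exports.

Local Open Scope classical_set_scope.
Local Open Scope ring_scope.

(* The probability space [0, 1] is the real line with Lebesgue measure
   restricted to [0, 1]; values of functions outside [0, 1] are irrelevant. *)
Definition unit_leb (R : realType) : set (measurableTypeR R) -> \bar R :=
  mrestr lebesgue_measure (measurable_itv `[0, 1 : R]).

HB.instance Definition _ (R : realType) := Measure.on (@unit_leb R).

Lemma unit_leb_setT (R : realType) : @unit_leb R [set: _] = 1%E.
Proof.
by rewrite /unit_leb /mrestr setTI lebesgue_measure_itv /= lte_fin ltr01 oppr0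
  adde0.
Qed.

HB.instance Definition _ (R : realType) :=
  @Measure_isProbability.Build _ _ R (@unit_leb R) (@unit_leb_setT R).

Section tuple_measure.
Context (d : measure_display) (T : measurableType d) (R : realType).

Definition tuple_cons (n : nat) (x : T * n.-tuple T) : n.+1.-tuple T :=
  [the n.+1.-tuple T of x.1 :: x.2].

Lemma measurable_tuple_cons n : measurable_fun [set: _] (@tuple_cons n).
Proof. exact: measurable_cons measurable_fst measurable_snd. Qed.

HB.instance Definition _ n :=
  isMeasurableFun.Build _ _ _ _ (@tuple_cons n) (@measurable_tuple_cons n).

(* The n-fold power of P, on n-tuples with the product sigma-algebra. *)
Fixpoint tuple_prob (P : probability T R) (n : nat) :
    probability (n.-tuple T) R :=
  if n is m.+1
  then distribution (P \x tuple_prob P m)%E (@tuple_cons m)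
  else dirac [tuple].

Lemma tuple_prob_box (P : probability T R) n (A : 'I_n -> set T) :
  (forall i, measurable (A i)) ->
  tuple_prob P n [set w | forall i, A i (tnth w i)] =
  (\prod_(i < n) P (A i))%E.
Proof.
elim: n A => [|n IHn] A mA /=.
  by rewrite big_ord0 diracE mem_set// => -[].
rewrite big_ord_recl -IHn; last by move=> i; exact: mA.
rewrite /distribution /pushforward /=.
set B := [set w | forall i, A (lift ord0 i) (tnth w i)].
rewrite (_ : _ @^-1` _ = A ord0 `*` B).
  rewrite product_measure1E//.
  rewrite (_ : B = \bigcap_(i in [set: 'I_n])
      ((fun w : n.-tuple T => tnth w i) @^-1` A (lift ord0 i))); last first.
    by apply/seteqP; split=> w /= wB i; [move=> _|]; exact: wB.
  apply: fin_bigcap_measurable => // i _.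
  by rewrite -[_ @^-1` _]setTI; exact: measurable_tnth.
apply/seteqP; split=> -[x w] /=.
  move=> xwA; split=> [|i]; first by have := xwA ord0.
  by have := xwA (lift ord0 i); rewrite tnthS.
move=> [xA wB] i; have [j ->|->] := unliftP ord0 i; last exact: xA.
by rewrite tnthS; exact: wB.
Qed.

End tuple_measure.

Section expL.
Context (R : realType).
Local Open Scope ereal_scope.

(* Decreasing rearrangement. For t > 0 the infimum is over a nonempty set; at
   t = 0 it is the junk value 0 when f is unbounded, which is immaterial. *)
Definition rearrangement (d : measure_display) (T : measurableType d)
    (P : probability T R) (f : T -> R) (t : R) : R :=
  inf [set s : R | (0 <= s)%R /\ P [set x | (s < `|f x|)%R] <= t%:E].

Definition orlicz_fun (p u : R) : R := (expR (u `^ p) - 1)%R.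

(* Norm of exp(L_p), for 1 <= p <= +oo; it is +oo when the set of admissible
   lambda is empty. *)
Definition expL_norm (p : \bar R) (x : R -> R) : \bar R :=
  if p is q%:E then
    ereal_inf [set l%:E | l in [set l : R | (0 < l)%R /\
      \int[@unit_leb R]_t (orlicz_fun q (`|x t| / l))%:E <= 1]]
  else Lnorm (@unit_leb R) +oo (EFin \o x).

Definition expL (p : \bar R) : set (R -> R) :=
  [set x | (@unit_leb R).-integrable [set: _] (EFin \o x) /\
           expL_norm p x < +oo].

Definition expL_on_norm (d : measure_display) (T : measurableType d)
    (P : probability T R) (p : \bar R) (f : T -> R) : \bar R :=
  expL_norm p (rearrangement P f).

Definition expL_on (d : measure_display) (T : measurableType d)
    (P : probability T R) (p : \bar R) : set (T -> R) :=
  [set f | P.-integrable [set: _] (EFin \o f) /\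
           expL p (rearrangement P f)].

Definition centered_bernoulli (r : {RV (@unit_leb R) >-> R}) : Prop :=
  unit_leb (r @^-1` [set 1%R]) = (2^-1)%:E /\
  unit_leb (r @^-1` [set (-1)%R]) = (2^-1)%:E.

Definition cube (n : nat) : probability (n.-tuple (measurableTypeR R)) R :=
  tuple_prob (@unit_leb R) n.

(* A point (s_1, t_1, ..., s_n, t_n) of [0, 1]^{2n} is a tuple w in which s_k
   and t_k have the 0-based positions 2(k-1) and 2(k-1)+1. *)
Definition opA (r : R -> R) (n : nat) (f : R -> R)
    (w : n.*2.-tuple (measurableTypeR R)) : R :=
  (\sum_(k < n) f (nth 0 w k.*2) * r (nth 0 w k.*2.+1))%R.

(* Operator norm of A_n from exp(L_p) to exp(L_p)([0, 1]^{2n}): the least bound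
   M, and +oo if A_n is not a bounded operator between these spaces. *)
Definition opA_norm (p : \bar R) (r : R -> R) (n : nat) : \bar R :=
  ereal_inf [set M%:E | M in [set M : R | (0 <= M)%R /\
    forall f, expL p f ->
      expL_on (cube n.*2) p (opA r f) /\
      expL_on_norm (cube n.*2) p (opA r f) <= M%:E * expL_norm p f]].

End expL.

(* Main.v *)
Require Import Defs.
From HB Require Import structures.
From mathcomp Require Import all_boot all_order all_algebra.
From mathcomp Require Import all_classical all_reals all_analysis.
From mathcomp Require Import lra measurable_realfun ess_sup_inf.
Import Order.TTheory GRing.Theory Num.Theory.
Import numFieldNormedType.Exports.
Local Open Scope classical_set_scope.
Local Open Scope ring_scope.
Set Implicit Arguments.
Unset Strict Implicit.
Unset Printing Implicit Defensive.

(** Membership in exp(L_p) is a growth condition on even moments: normalized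
    functions satisfy [E f^(2j) <= 2^j (2j)!^(1/p)], and conversely such a
    growth, with a small enough geometric factor, bounds the Orlicz integral.
    So the problem reduces to the even moments of
    [S_n = f(s_1) r(t_1) + ... + f(s_n) r(t_n)], uniformly in the exponent.

    Put [theta = 1 - 1/p]. Averaging over the signs kills the odd terms of the
    binomial formula, so
    [E S_(n+1)^(2m) = sum_j C(2m, 2j) E f^(2j) E S_n^(2(m-j))].
    Unrolling this recursion, the multinomial coefficients
    [(2m)! / prod_i (2 a_i)!] appear to the power [theta]; up to a factor [4^m]
    they are at most the squares of [m! / prod_i a_i!]. Hence for every
    [sg >= max (1, 2 theta)],
    [sum_a (m! / prod_i a_i!)^(2 theta) <= (sum_a m! / prod_i a_i!)^sg
     = n^(m sg)],
    and [S_n / n^(sg/2)] satisfies the same moment growth as [f] up to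
    constants. The choice [sg = 1] is possible when [p <= 2] and gives
    [sqrt n]; the choice [sg = 2 theta] is possible when [p >= 2] and gives
    [n^(1 - 1/p)]. The induction is [opA_even_moment], its combinatorial step
    is [moment_bound_rec], and the passages between moments and Orlicz
    integrals are [orlicz_even_moment] and [expR_moment_bound].

    The norm of a function on the cube is that of its decreasing rearrangement,
    which has the same law as its absolute value
    ([ge0_integral_rearrangement]); so Orlicz integrals may be computed on the
    cube itself. For [p = +oo], [`|S_n| <= n `|f|_oo] almost everywhere. *)

(** * Real powers, exponentials and even power series *)

Lemma exprN_double (R : pzRingType) (x : R) (k : nat) :
  (- x) ^+ k.*2 = x ^+ k.*2.
Proof. by rewrite -mul2n !exprM sqrrN. Qed.

Lemma expr_double_ge0 (R : realDomainType) (x : R) (k : nat) : 0 <= x ^+ k.*2.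
Proof. by rewrite -mul2n exprM exprn_ge0// sqr_ge0. Qed.

(** Each [y i `^ (s - 1)] is at most the [s - 1]-st power of the total. *)
Lemma powR_sum_superadditive (R : realType) (s : R) (I : Type) (l : seq I)
    (y : I -> R) : 1 <= s -> (forall i, 0 <= y i) ->
  \sum_(i <- l) y i `^ s <= (\sum_(i <- l) y i) `^ s.
Proof.
move=> s1 y0; have s0 : 0 < s by exact: lt_le_trans s1.
have T0 : 0 <= \sum_(i <- l) y i by exact: sumr_ge0.
rewrite -(mulr_powRB1 T0 s0) mulr_suml.
elim: l T0 => [|a l IH] T0; first by rewrite !big_nil.
rewrite !big_cons; apply: lerD.
  rewrite -(mulr_powRB1 (y0 a) s0) ler_wpM2l//.
  by rewrite ge0_ler_powR ?nnegrE ?subr_ge0// ?addr_ge0 ?lerDl ?sumr_ge0.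
apply: le_trans (IH _) _; first exact: sumr_ge0.
apply: ler_sum => i _; rewrite ler_wpM2l//.
by rewrite ge0_ler_powR ?nnegrE ?subr_ge0// ?addr_ge0 ?lerDr ?sumr_ge0.
Qed.

Lemma powRK (R : realType) (p x : R) : 0 < p -> 0 <= x ->
  (x `^ p) `^ p^-1 = x.
Proof. by move=> p0 x0; rewrite -powRrM divff ?gt_eqF// powRr1. Qed.

Lemma powRX (R : realType) (x s : R) (n : nat) : 0 <= x ->
  (x ^+ n) `^ s = (x `^ s) ^+ n.
Proof.
by move=> x0; rewrite -[x ^+ n]powR_mulrn// powRAC powR_mulrn ?powR_ge0.
Qed.

Lemma series_exp_coeff_even (R : realType) (v : R) (M : nat) :
  series (exp_coeff v) M.*2 + series (exp_coeff (- v)) M.*2 =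
  2 * \sum_(m < M) v ^+ m.*2 / (m.*2)`!%:R.
Proof.
elim: M => [|M IH].
  by rewrite /series/= !big_geq// big_ord0 addr0 mulr0.
rewrite doubleS big_ord_recr/= mulrDr -IH !seriesSr /exp_coeff/=.
rewrite exprS [(- v) ^+ _.+1]exprS exprN_double !mulNr; lra.
Qed.

(** The even part of the exponential series is the hyperbolic cosine, which is
    at least half the exponential. *)
Lemma expR_le_even_series (R : realType) (v K : R) :
  (forall M, \sum_(m < M) v ^+ m.*2 / (m.*2)`!%:R <= K) -> expR v <= 2 * K.
Proof.
move=> vK.
have dbl : M.*2 @[M --> \oo] --> \oo.
  apply/cvgnyPge => A; near=> M.
  rewrite -addnn; apply: leq_trans (leq_addr _ _).
  by near: M; exact: nbhs_infty_ge.
have cexp (w : R) : series (exp_coeff w) M.*2 @[M --> \oo] --> expR w.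
  by apply: (cvg_comp _ _ dbl); exact: is_cvg_series_exp_coeff.
have e := cvg_lim (@norm_hausdorff _ _) (cvgD (cexp v) (cexp (- v))).
apply: (@le_trans _ _ (expR v + expR (- v))); first by rewrite lerDl expR_ge0.
rewrite -e; apply: limr_le.
  by apply/cvg_ex; eexists; exact: cvgD (cexp v) (cexp (- v)).
apply: nearW => M; rewrite [_ M]/=.
rewrite -[_ M]/(series (exp_coeff v) M.*2 + series (exp_coeff (- v)) M.*2).
rewrite series_exp_coeff_even ler_pM2l//.
Unshelve. all: by end_near. Qed.

(** Converse direction of the moment characterization, pointwise. With
    [v = u `^ p], superadditivity of [x `^ p] gives
    [cosh v <= (sum_m (v^(2m) / (2m)!)^(1/p))^p], and the terms of that sum are
    [u^(2m) / (2m)!^(1/p)]; the left side is the [p]-th root of [exp v]. *)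
Lemma expR_powR_le_series (R : realType) (p u : R) : 1 <= p -> 0 <= u ->
  ((expR (u `^ p / p))%:E <=
   2%:E * \sum_(0 <= m <oo) (u ^+ m.*2 / ((m.*2)`!%:R `^ p^-1))%:E)%E.
Proof.
move=> p1 u0; have p0 : 0 < p by exact: lt_le_trans p1.
set B := (\sum_(_ <= _ <oo) _)%E.
have t0 m : (0 <= (u ^+ m.*2 / ((m.*2)`!%:R `^ p^-1))%:E)%E.
  by rewrite lee_fin divr_ge0 ?exprn_ge0 ?powR_ge0.
have B0 : (0 <= B)%E by apply: nneseries_ge0 => m _ _; exact: t0.
case: {2}B (erefl B) => [b eB|eB|eB]; last 2 first.
- by rewrite eB gt0_muley ?leey ?lte_fin.
- by move: B0; rewrite eB.
have b0 : 0 <= b by rewrite -lee_fin -eB.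
have Mb M : \sum_(m < M) (u ^+ m.*2 / ((m.*2)`!%:R `^ p^-1)) <= b.
  rewrite -lee_fin -eB -sumEFin -(big_mkord xpredT (fun m =>
    (u ^+ m.*2 / ((m.*2)`!%:R `^ p^-1))%:E)).
  by apply: nneseries_lim_ge => m _ _; exact: t0.
have ev : expR (u `^ p) <= 2 * b `^ p.
  apply: expR_le_even_series => M.
  rewrite (eq_bigr (fun m : 'I_M =>
     (u ^+ m.*2 / ((m.*2)`!%:R `^ p^-1)) `^ p)); last first.
    move=> m _; rewrite powRM ?exprn_ge0 ?invr_ge0 ?powR_ge0//.
    rewrite powRX//; congr (_ * _).
    by rewrite -[X in _ = X `^ _]powRN -powRrM mulNr mulVf ?gt_eqF// powR_inv1.
  apply: le_trans (@powR_sum_superadditive R p _ _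
    (fun m : 'I_M => u ^+ m.*2 / ((m.*2)`!%:R `^ p^-1)) p1 _) _.
    by move=> m; rewrite divr_ge0 ?exprn_ge0 ?powR_ge0.
  apply: ge0_ler_powR (Mb M) => //; rewrite ?ltW// nnegrE ?sumr_ge0// => i _.
  by rewrite divr_ge0 ?exprn_ge0 ?powR_ge0.
rewrite eB -EFinM lee_fin.
rewrite expRM -[b in leRHS](powRK p0 b0).
apply: le_trans (_ : (2 * b `^ p) `^ p^-1 <= _).
  by apply: ge0_ler_powR ev; rewrite ?invr_ge0 ?nnegrE ?expR_ge0 ?mulr_ge0
    ?powR_ge0// ltW.
rewrite powRM ?powR_ge0// ler_wpM2r ?powR_ge0// ler1_powR ?ler1n//.
by rewrite invf_le1.
Qed.

(** Convexity: dividing the argument of [exp - 1] by 3 divides its value by at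
    least 3. The factor 3 is what turns the bound [4 - 1] obtained later for the
    integral on the right into the bound 1 of a unit ball. *)
Lemma orlicz_fun_scale (R : realType) (p u : R) : 1 <= p -> 0 <= u ->
  orlicz_fun p (u / (3 * p)) <= 3^-1 * (expR (u `^ p / p) - 1).
Proof.
move=> p1 u0; have p0 : 0 < p by exact: lt_le_trans p1.
have step (c w : R) : 1 <= c -> 0 <= w -> (w / c) `^ p <= w `^ p / c.
  move=> c1 w0; have c0 : 0 < c by exact: lt_le_trans c1.
  rewrite powRM ?invr_ge0 ?(ltW c0)// ler_wpM2l ?powR_ge0//.
  by rewrite ge1r_powR// invr_gt0 c0 invf_le1.
have e : (u / (3 * p)) `^ p <= u `^ p / p / 3.
  rewrite invfM [3^-1 * _]mulrC mulrA; apply: le_trans (step _ _ _ _) _ => //.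
  - by rewrite ler1n.
  - by rewrite divr_ge0// ltW.
  by rewrite ler_pM2r ?invr_gt0// step.
rewrite /orlicz_fun; move: e; set a := _ `^ p; set w := _ / p => e.
have w0 : 0 <= w by rewrite divr_ge0 ?powR_ge0 ?ltW.
have x1 : 1 <= expR (w / 3) by rewrite -expR0 ler_expR divr_ge0.
(* In terms of x = exp (w / 3): x - 1 <= (x^3 - 1) / 3 for x >= 1. *)
have -> : expR w = expR (w / 3) ^+ 3.
  by rewrite -expRM_natl; rewrite mulrC divfK.
rewrite -ler_expR in e; apply: le_trans (lerB e (lexx 1)) _.
move: (expR (w / 3)) x1 => x x1; rewrite ler_pdivlMl// -subr_ge0.
have -> : x ^+ 3 - 1 - 3 * (x - 1) = (x - 1) ^+ 2 * (x + 2) by lra.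
by rewrite mulr_ge0 ?sqr_ge0// addr_ge0// (le_trans ler01).
Qed.

(** A single term of the exponential series, [(u^p)^k / k! <= exp (u^p)], raised
    to the power [1/p]. *)
Lemma expr_le_expR_powR (R : realType) (p u : R) (k : nat) : 1 <= p -> 0 <= u ->
  u ^+ k <= k`!%:R `^ p^-1 * expR (u `^ p).
Proof.
move=> p1 u0; have p0 : 0 < p by exact: lt_le_trans p1.
have e : (u `^ p) ^+ k <= k`!%:R * expR (u `^ p).
  rewrite mulrC -ler_pdivrMr ?ltr0n ?fact_gt0//; case: k => [|k].
    by rewrite expr0 divr1 -expR0 ler_expR powR_ge0.
  by apply: le_trans (expR_ge1Dxn k (powR_ge0 u p)); rewrite lerDr ler01.
have -> : u ^+ k = ((u `^ p) ^+ k) `^ p^-1 by rewrite powRX ?powR_ge0// powRK.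
apply: le_trans (_ : (k`!%:R * expR (u `^ p)) `^ p^-1 <= _).
  by apply: ge0_ler_powR e; rewrite ?invr_ge0 ?nnegrE ?mulr_ge0 ?exprn_ge0
    ?powR_ge0 ?expR_ge0// ltW.
rewrite powRM ?expR_ge0// ler_wpM2l ?powR_ge0// ler1_powR ?invf_le1//.
by rewrite -expR0 ler_expR powR_ge0.
Qed.

(** * Combinatorics of the moment recursion *)

Lemma sum_even_odd (V : nmodType) (F : nat -> V) (m : nat) :
  \sum_(i < m.*2.+1) F i = \sum_(j < m.+1) F j.*2 + \sum_(j < m) F j.*2.+1.
Proof.
elim: m => [|m IH]; first by rewrite !big_ord_recr !big_ord0/= addr0.
rewrite [in LHS]doubleS [LHS]big_ord_recr [X in X + _ = _]big_ord_recr/= IH.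
rewrite [X in _ = X + _]big_ord_recr [X in _ = _ + X]big_ord_recr/= !doubleS.
by rewrite [RHS]addrACA [F _.+2 + _]addrC addrA.
Qed.

(** Averaging over the sign of [x] cancels the odd powers of [x]. *)
Lemma symmetrized_even_power (R : realType) (a x : R) (m : nat) :
  2^-1 * (a + x) ^+ m.*2 + 2^-1 * (a - x) ^+ m.*2 =
  \sum_(j < m.+1) 'C(m.*2, j.*2)%:R * (x ^+ j.*2 * a ^+ (m - j).*2).
Proof.
rewrite -mulrDr !exprDn -big_split/=.
rewrite (sum_even_odd (fun i => a ^+ (m.*2 - i) * x ^+ i *+ 'C(m.*2, i) +
  a ^+ (m.*2 - i) * (- x) ^+ i *+ 'C(m.*2, i))).
rewrite [X in _ + X]big1 ?addr0; last first.
  move=> j _; rewrite -mulrnDl -mulrDr exprS [(- x) ^+ _.+1]exprS.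
  by rewrite exprN_double -mulrDl subrr mul0r mulr0 mul0rn.
rewrite mulr_sumr; apply: eq_bigr => j _.
rewrite exprN_double -mulr2n.
rewrite doubleB -[_ *+ 'C(_, _) *+ 2]mulr_natl mulKf ?pnatr_eq0//.
by rewrite mulr_natl [x ^+ _ * _]mulrC.
Qed.

Section moment_bound.
Context {R : realType}.
Implicit Types (sg tau : R) (m n : nat).

(** The bound for the [2m]-th moment of a sum of [n] terms. With
    [tau = 2 (1 - 1/p)] the factor [(2m)! / m!^tau] is [(2m)!^(1/p)] up to
    [4^m] (see [fact_double_powR]), but unlike [(2m)!^(1/p)] it makes the
    recursion below close without loss of constants. *)
Definition moment_bound sg tau m n : R :=
  2 ^+ m * (m.*2)`!%:R / (m`!%:R `^ tau) * (n%:R ^+ m) `^ sg.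

Lemma moment_bound_ge0 sg tau m n : 0 <= moment_bound sg tau m n.
Proof. by rewrite !mulr_ge0 ?invr_ge0 ?powR_ge0. Qed.

(** In each term the factorials combine to those of [m], leaving
    ['C(m, j)^tau (n^(m-j))^sg <= ('C(m, j) n^(m-j))^sg]; superadditivity of
    the [sg]-th power and the binomial formula for [(n + 1)^m] conclude. *)
Lemma moment_bound_rec sg tau m n : 1 <= sg -> tau <= sg ->
  \sum_(j < m.+1) 'C(m.*2, j.*2)%:R *
    ((2 ^+ j * (j.*2)`!%:R / (j`!%:R `^ tau)) * moment_bound sg tau (m - j) n)
  <= moment_bound sg tau m n.+1.
Proof.
move=> sg1 tausg; rewrite {2}/moment_bound.
rewrite -[n.+1%:R]natr1 (exprDn n%:R).
under [X in X `^ sg]eq_bigr do rewrite expr1n mulr1.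
apply: le_trans (ler_wpM2l _ (@powR_sum_superadditive R sg _ _
  (fun j : 'I_m.+1 => n%:R ^+ (m - j) *+ 'C(m, j)) sg1 _)); last 2 first.
- by rewrite !mulr_ge0 ?invr_ge0 ?powR_ge0.
- by move=> j; rewrite mulrn_wge0 ?exprn_ge0.
rewrite mulr_sumr; apply: ler_sum => -[j /=]; rewrite ltnS => jm _.
rewrite /moment_bound.
have e2 : (m.*2)`!%:R =
    'C(m.*2, j.*2)%:R * ((j.*2)`!%:R * ((m - j).*2)`!%:R) :> R.
  by rewrite -!natrM doubleB bin_fact// leq_double.
have e1 : m`!%:R `^ tau =
    'C(m, j)%:R `^ tau * (j`!%:R `^ tau * (m - j)`!%:R `^ tau) :> R.
  by rewrite -powRM// -powRM ?mulr_ge0// -!natrM bin_fact.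
have e0 : 2 ^+ m = 2 ^+ j * 2 ^+ (m - j) :> R by rewrite -exprD subnKC.
have c1 : 1 <= 'C(m, j)%:R :> R by rewrite ler1n bin_gt0.
rewrite e2 e1 e0 -[_ ^+ _ *+ 'C(_, _)]mulr_natr powRM ?exprn_ge0//.
set C2 := 'C(_, _)%:R; set A := (_)`!%:R; set B := ((m - j).*2)`!%:R.
set a := _ `^ tau; set b := (m - j)`!%:R `^ tau; set y := _ `^ sg.
have := ler_powR c1 tausg; set c := _ `^ tau; set d := _ `^ sg => cd.
have c0 : c != 0 by rewrite gt_eqF// powR_gt0// (lt_le_trans ltr01).
rewrite !invfM.
set Q := C2 * A * B * (2 ^+ j * 2 ^+ (m - j)) * a^-1 * b^-1 * y.
have -> : C2 * (2 ^+ j * A / a * (2 ^+ (m - j) * B / b * y)) = Q.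
  by rewrite /Q; lra.
have -> : 2 ^+ j * 2 ^+ (m - j) * (C2 * (A * B)) * (c^-1 * (a^-1 * b^-1)) *
    (y * d) = Q * (d / c) by rewrite /Q; lra.
rewrite ler_peMr//; first by rewrite !mulr_ge0 ?invr_ge0 ?powR_ge0.
by rewrite ler_pdivlMr ?mul1r// lt_def c0 powR_ge0.
Qed.

Lemma fact_double_ge m : (m`! ^ 2 <= (m.*2)`!)%N.
Proof.
rewrite -(@bin_fact m.*2 m) -?addnn ?leq_addr// addnK -mulnn leq_pmull//.
by rewrite bin_gt0 leq_addr.
Qed.

Lemma bin_le_exp2 n m : ('C(n, m) <= 2 ^ n)%N.
Proof.
elim: n m => [|n IH] [|m]; rewrite ?bin0 ?expn_gt0 ?bin0n//.
by rewrite binS expnS mul2n -addnn leq_add.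
Qed.

Lemma fact_double_le m : ((m.*2)`! <= 4 ^ m * m`! ^ 2)%N.
Proof.
have -> : (4 ^ m = 2 ^ m.*2)%N by rewrite -mul2n expnM.
rewrite -(@bin_fact m.*2 m) -addnn ?leq_addr// addnK -mulnn leq_mul2r.
by rewrite bin_le_exp2 orbT.
Qed.

(** Since [1 <= (2m)! / m!^2 <= 4^m], the two normalizations of the moments
    differ by at most [4^m]: their quotient is the [(1 - 1/p)]-th power of
    [(2m)! / m!^2]. *)
Lemma fact_double_powR (p : R) m : 1 <= p ->
  (m.*2)`!%:R `^ p^-1 <= (m.*2)`!%:R / (m`!%:R `^ (2 * (1 - p^-1)))
  <= 4 ^+ m * (m.*2)`!%:R `^ p^-1.
Proof.
move=> p1; have p0 : 0 < p by exact: lt_le_trans p1.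
set th := 1 - p^-1; have th0 : 0 <= th by rewrite subr_ge0 invf_le1.
have th1 : th <= 1 by rewrite gerBl invr_ge0 ltW.
have f0 k : 0 < k`!%:R :> R by rewrite ltr0n fact_gt0.
have e : (m.*2)`!%:R = (m.*2)`!%:R `^ p^-1 * (m.*2)`!%:R `^ th :> R.
  rewrite -powRD; first by rewrite subrKC powRr1.
  by rewrite subrKC (gt_eqF (f0 _)) implybT.
have e2 : m`!%:R `^ (2 * th) = (m`! ^ 2)%:R `^ th :> R.
  by rewrite powRrM powR_mulrn// -natrX.
rewrite e2; apply/andP; split.
  rewrite ler_pdivlMr ?powR_gt0 ?ltr0n ?expn_gt0 ?fact_gt0//.
  rewrite [leRHS]e ler_wpM2l ?powR_ge0// ge0_ler_powR ?nnegrE//.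
  by rewrite ler_nat fact_double_ge.
rewrite ler_pdivrMr ?powR_gt0 ?ltr0n ?expn_gt0 ?fact_gt0//.
rewrite [leLHS]e [4 ^+ m * _]mulrC -mulrA ler_wpM2l ?powR_ge0//.
apply: le_trans (_ : (4 ^+ m * (m`! ^ 2)%:R) `^ th <= _).
  rewrite ge0_ler_powR ?nnegrE ?mulr_ge0// -natrX -natrM ler_nat.
  exact: fact_double_le.
rewrite powRM ?exprn_ge0// ler_wpM2r ?powR_ge0// ler1_powR//.
by rewrite exprn_ege1// ler1n.
Qed.

End moment_bound.

(** * The decreasing rearrangement *)

Lemma measurable_normr_gt d (T : measurableType d) (R : realType) (g : T -> R)
    (c : R) : measurable_fun [set: T] g -> measurable [set x | c < `|g x|].
Proof.
move=> mg; rewrite (_ : mkset _ = (Num.norm \o g) @^-1` `]c, +oo[).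
  by rewrite -[_ @^-1` _]setTI; apply: measurableT_comp.
by apply/seteqP; split=> x /=; rewrite in_itv/= andbT.
Qed.

Lemma measurable_normr_le d (T : measurableType d) (R : realType) (g : T -> R)
    (c : R) : measurable_fun [set: T] g -> measurable [set x | `|g x| <= c].
Proof.
move=> mg; rewrite (_ : mkset _ = ~` [set x | c < `|g x|]).
  by apply: measurableC; exact: measurable_normr_gt.
by apply/seteqP; split=> x /=; rewrite leNgt => /negP.
Qed.

Section rearrangement.
Context d (T : measurableType d) (R : realType) (P : probability T R).
Variable f : T -> R.
Implicit Types s t : R.
Hypothesis mf : measurable_fun [set: T] f.
Local Notation phi := (rearrangement P f).
Local Notation tail s := [set x | s < `|f x|].

Let mtail s : measurable (tail s).
Proof. exact: measurable_normr_gt. Qed.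

Let level (t : R) := [set s : R | 0 <= s /\ (P (tail s) <= t%:E)%E].

Let level_lb t : has_lbound (level t).
Proof. by exists 0 => s []. Qed.

Lemma rearrangement_ge0 t : 0 <= phi t.
Proof.
have [[s ls]|ne] := pselect (level t !=set0).
  by apply: lb_le_inf; [exists s | move=> u []].
by rewrite /rearrangement inf_out// => -[].
Qed.

Let tail_le s (s' : R) : s <= s' -> (P (tail s') <= P (tail s))%E.
Proof.
by move=> ss'; apply: le_measure; rewrite ?inE// => x /=; exact: le_lt_trans.
Qed.

Let level_ne0 t : 0 < t -> level t !=set0.
Proof.
move=> t0; apply: contrapT => ne.
have tP (n : nat) : (t%:E <= P (tail n%:R))%E.
  by rewrite leNgt; apply/negP => /ltW h; apply: ne; exists n%:R.
have cv : P (tail n%:R) @[n --> \oo] --> P (\bigcap_n tail n%:R).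
  apply: nonincreasing_cvg_mu => //.
  - exact: le_lt_trans (probability_le1 _ _) (ltry _).
  - exact: bigcapT_measurable.
  - move=> n m nm; apply/subsetPset => x /=; apply: le_lt_trans.
    by rewrite ler_nat.
have e0 : \bigcap_n tail n%:R = set0.
  apply/seteqP; split => // x /(_ (Num.truncn `|f x|).+1 Logic.I)/=.
  by rewrite ltNge => /negP; apply; apply/ltW/truncnS_gt.
have : (t%:E <= limn (fun n => P (tail n%:R)))%E.
  by apply: lime_ge; [exact: cvgP cv | exact: nearW].
by rewrite (cvg_lim (@ereal_hausdorff R) cv) e0 measure0 lee_fin leNgt t0.
Qed.

(** Right continuity of the distribution function makes the rearrangement its
    exact generalized inverse. *)
Lemma lt_rearrangement t s : 0 < t -> 0 <= s ->
  (s < phi t) = (t%:E < P (tail s))%E.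
Proof.
move=> t0 s0; rewrite !ltNge; congr negb; apply/idP/idP; last first.
  by move=> st; apply: (ge_inf (level_lb t)).
move=> phis.
have cv : P (tail (s + n.+1%:R^-1)) @[n --> \oo] -->
    P (\bigcup_n tail (s + n.+1%:R^-1)).
  apply: nondecreasing_cvg_mu => //; first exact: bigcupT_measurable.
  move=> n m nm; apply/subsetPset => x /=; apply: le_lt_trans.
  by rewrite lerD2l lef_pV2 ?posrE// ler_nat.
have eU : \bigcup_n tail (s + n.+1%:R^-1) = tail s.
  apply/seteqP; split=> [x [n _]/=|x /= sx].
    by apply: lt_trans; rewrite ltrDl.
  have d0 : 0 < `|f x| - s by rewrite subr_gt0.
  exists (Num.truncn (`|f x| - s)^-1) => //=.
  rewrite -ltrBrDl -[ltRHS]invrK ltf_pV2 ?posrE ?invr_gt0//.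
  exact: truncnS_gt.
rewrite eU in cv; rewrite -(cvg_lim (@ereal_hausdorff R) cv).
apply: lime_le; first exact: cvgP cv.
apply: nearW => n.
have n0 : 0 < n.+1%:R^-1 :> R by [].
have [e [e0 le] elt] := inf_adherent n0 (conj (level_ne0 t0) (level_lb t)).
apply: le_trans (tail_le _) le; apply: ltW; apply: lt_le_trans elt _.
by rewrite lerD2r.
Qed.

Let rearrangement_neg t : t < 0 -> phi t = 0.
Proof.
move=> t0; rewrite /rearrangement inf_out// => -[[s [_]]] + _.
by apply/negP; rewrite -ltNge (lt_le_trans _ (measure_ge0 P _))// lte_fin.
Qed.

Let rearrangement_ray s : 0 <= s ->
  phi @^-1` `]s, +oo[ =
  `]0, fine (P (tail s))[ `|` ([set 0] `&` phi @^-1` `]s, +oo[).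
Proof.
move=> s0; have fP : P (tail s) \is a fin_num by exact: fin_num_measure.
apply/seteqP; split=> t /=; rewrite !in_itv/= andbT; last first.
  by move=> [/andP[t0]|[] //]; rewrite lt_rearrangement// -lte_fin fineK.
move=> st; have [t0|t0|t0] := ltgtP t 0; last by right.
  by move: st; rewrite rearrangement_neg// ltNge s0.
by left; rewrite -lte_fin fineK// -lt_rearrangement.
Qed.

Lemma measurable_rearrangement :
  measurable_fun [set: measurableTypeR R] (phi : measurableTypeR R -> R).
Proof.
move=> mD; apply: (measurability _ (RGenOInfty.measurableE R)) => //.
move=> _ [_ [s ->] <-]; rewrite setTI.
have [s0|s0] := leP 0 s; last first.
  rewrite (_ : _ @^-1` _ = setT)//; apply/seteqP; split => // t _ /=.
  by rewrite in_itv/= andbT (lt_le_trans s0)// rearrangement_ge0.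
rewrite rearrangement_ray//; apply: measurableU => //.
have [h|h] := pselect (phi 0 \in `]s, +oo[).
  by rewrite (_ : _ `&` _ = [set 0])//; apply/seteqP; split=> [t []//|t/= ->].
by rewrite (_ : _ `&` _ = set0)//; apply/seteqP; split=> // t/= [->].
Qed.

(** Up to the point [0], the set where the rearrangement exceeds [s] is the
    interval from [0] to the measure of the set where [`|f|] exceeds [s]. *)
Lemma unit_leb_rearrangement_ray s :
  unit_leb (phi @^-1` `]s, +oo[) = P ((Num.norm \o f) @^-1` `]s, +oo[).
Proof.
have mphi A : measurable A -> measurable (phi @^-1` A).
  by move=> mA; rewrite -[_ @^-1` _]setTI; exact: measurable_rearrangement.
have [s0|s0] := leP 0 s; last first.
  rewrite (_ : _ @^-1` _ = setT); last first.
    apply/seteqP; split => // t _ /=.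
    by rewrite in_itv/= andbT (lt_le_trans s0)// rearrangement_ge0.
  rewrite unit_leb_setT (_ : _ @^-1` _ = setT) ?probability_setT//.
  apply/seteqP; split => // t _ /=.
  by rewrite in_itv/= andbT (lt_le_trans s0).
rewrite (_ : _ @^-1` _ = tail s :> set T); last first.
  by apply/seteqP; split=> x /=; rewrite in_itv/= andbT.
have fP : P (tail s) \is a fin_num by exact: fin_num_measure.
have F1 : fine (P (tail s)) <= 1 by rewrite -lee_fin fineK// probability_le1.
have F0 : 0 <= fine (P (tail s)) by rewrite fine_ge0.
have lebF a b : lebesgue_measure
    [set` Interval (BSide a 0) (BSide b (fine (P (tail s))))] =
    P (tail s).
  rewrite lebesgue_measure_itv/= lte_fin; case: ltP => F00.
    by rewrite oppr0 adde0 fineK.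
  by rewrite -[RHS]fineK//; congr EFin; apply/eqP; rewrite eq_le F0.
apply/eqP; rewrite eq_le /unit_leb /mrestr; apply/andP; split.
  rewrite -[leRHS](lebF true false); apply: le_measure; rewrite ?inE//.
    by apply: measurableI => //; exact: mphi.
  rewrite rearrangement_ray// => t/= [[tF|[-> _]] _].
    by move: tF; rewrite !in_itv/= => /andP[/ltW -> /ltW ->].
  by rewrite in_itv/= lexx/=.
rewrite -[leLHS](lebF false true); apply: le_measure; rewrite ?inE//.
  by apply: measurableI => //; exact: mphi.
rewrite rearrangement_ray// => t/= h; split; first by left.
by move: h; rewrite !in_itv/= => /andP[/ltW -> /ltW tF]; exact: le_trans tF F1.
Qed.

(** The laws of the rearrangement and of [`|f|] agree on the rays, a pi-system
    generating the Borel sets; hence they are equal. *)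
Lemma ge0_integral_rearrangement (G : R -> \bar R) :
  measurable_fun [set: R] G -> (forall y, 0 <= G y)%E ->
  (\int[@unit_leb R]_t G (phi t) = \int[P]_x G `|f x|%R)%E.
Proof.
move=> mG G0.
have mn : measurable_fun [set: T] (Num.norm \o f) by exact: measurableT_comp.
pose phi' : {RV (@unit_leb R) >-> R} :=
  HB.pack phi (isMeasurableFun.Build _ _ _ _ _ measurable_rearrangement).
pose n' : {RV P >-> R} :=
  HB.pack (Num.norm \o f) (isMeasurableFun.Build _ _ _ _ _ mn).
pose m1 : probability _ R := distribution (@unit_leb R) phi'.
pose m2 : probability _ R := distribution P n'.
have m12 A : measurable A -> m1 A = m2 A.
  apply: (@measure_unique _ R _ (@RGenOInfty.G R)
    (fun k => `](- k%:R), +oo[%classic) _ _ _ _ m1 m2).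
  - exact: RGenOInfty.measurableE.
  - move=> _ _ [a ->] [b ->]; exists (Num.max a b).
    by apply/seteqP; split=> x /=; rewrite !in_itv/= !andbT gt_max => /andP.
  - by move=> k; eexists.
  - apply/seteqP; split=> // x _; exists (Num.truncn `|x|).+1 => //=.
    rewrite in_itv/= andbT ltrNl (le_lt_trans _ (truncnS_gt _))//.
    by rewrite -normrN ler_norm.
  - by move=> _ [s ->]; exact: unit_leb_rearrangement_ray.
  - by move=> k; exact: le_lt_trans (probability_le1 _ _) (ltry _).
rewrite -[LHS]/(\int[@unit_leb R]_t (G \o phi') t)%E.
rewrite -(ge0_integral_distribution phi' mG G0).
rewrite -[RHS]/(\int[P]_t (G \o n') t)%E -(ge0_integral_distribution n' mG G0).
apply: (@eq_measure_integral _ _ _ _ m2) => A mA _; exact: m12.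
Qed.

End rearrangement.

(** * Moments of sums of independent symmetrized terms *)

Lemma ge0_integral_tuple_prob_recl d (T : measurableType d) (R : realType)
    (P : probability T R) (n : nat) (G : n.+1.-tuple T -> \bar R) :
  measurable_fun [set: n.+1.-tuple T] G -> (forall w, 0 <= G w)%E ->
  (\int[tuple_prob P n.+1]_w G w =
   \int[P]_x \int[tuple_prob P n]_w G (tuple_cons (x, w)))%E.
Proof.
move=> mG G0 /=; rewrite (ge0_integral_distribution _ mG G0).
rewrite fubini_tonelli1//=.
by apply: measurableT_comp => //; exact: measurable_tuple_cons.
Qed.

Section bernoulli_sums.
Context (R : realType) (r : {RV (@unit_leb R) >-> R}).
Hypothesis hr : centered_bernoulli r.

Let measurable_atom c : measurable (r @^-1` [set c]).
Proof. by rewrite -[_ @^-1` _]setTI; exact: measurable_funP. Qed.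

Let atoms_disjoint : r @^-1` [set 1] `&` r @^-1` [set (-1)] = set0.
Proof.
apply/seteqP; split=> // t [/= rt1 rtN1].
by move/eqP: rtN1; rewrite rt1 -subr_eq0 opprK -mulr2n pnatr_eq0.
Qed.

Lemma centered_bernoulli_support :
  unit_leb (r @^-1` [set 1] `|` r @^-1` [set (-1)]) = 1%E.
Proof.
have [r1 rN1] := hr.
transitivity (unit_leb (r @^-1` [set 1%R]) + unit_leb (r @^-1` [set (-1)%R]))%E.
  by apply: measureU;
    [exact: measurable_atom.. | exact: atoms_disjoint].
by rewrite r1 rN1 -EFinD; congr EFin; rewrite [RHS](@splitr R 1) div1r.
Qed.

Lemma ge0_integral_centered_bernoulli (G : R -> \bar R) :
  measurable_fun [set: R] G -> (forall y, 0 <= G y)%E ->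
  (\int[@unit_leb R]_t G (r t) = 2^-1%:E * G 1%R + 2^-1%:E * G (- 1)%R)%E.
Proof.
move=> mG G0; have [r1 rN1] := hr; have PAB := centered_bernoulli_support.
set A := r @^-1` [set 1] in r1 PAB; set B := r @^-1` [set (-1)] in rN1 PAB.
have [mA mB] : measurable A /\ measurable B by split; exact: measurable_atom.
have AB : A `&` B = set0 by exact: atoms_disjoint.
have mAB : measurable (A `|` B) by exact: measurableU.
have N0 : unit_leb (~` (A `|` B)) = 0%E.
  transitivity (1 - unit_leb (A `|` B))%E; first exact: probability_setC.
  by rewrite PAB subee.
have mGr : measurable_fun setT (fun t => G (r t)).
  exact: measurableT_comp.
rewrite -(setUv (A `|` B)) ge0_integral_setU//; last 3 first.
- exact: measurableC.
- by rewrite setUv.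
- by rewrite /disj_set setICr.
have mN : measurable (~` (A `|` B)) by exact: measurableC.
rewrite [X in (_ + X)%E](null_set_integral mN _ N0) ?adde0; last first.
  exact: measurable_funTS.
rewrite ge0_integral_setU//; last by rewrite /disj_set AB.
  have cI c D : measurable D -> (forall t, D t -> r t = c) ->
      (\int[@unit_leb R]_(t in D) G (r t) = unit_leb D * G c)%E.
    move=> mD Dc; transitivity (\int[@unit_leb R]_(t in D) cst (G c) t)%E.
      by apply: eq_integral => t /set_mem /Dc ->.
    by rewrite muleC; exact: integral_cst.
  by rewrite (cI 1 A mA)// (cI (-1) B mB)// r1 rN1.
exact: measurable_funTS.
Qed.

Lemma measurable_opA n (f : R -> R) :
  measurable_fun [set: measurableTypeR R] (f : measurableTypeR R -> R) ->
  measurable_fun [set: n.*2.-tuple (measurableTypeR R)] (@opA R r n f).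
Proof.
move=> mf; apply: measurable_sum => k.
have lt1 : (k.*2 < n.*2)%N by rewrite ltn_double.
have lt2 : (k.*2.+1 < n.*2)%N by rewrite ltn_Sdouble.
rewrite (_ : (fun _ => _) = (fun w => f (tnth w (Ordinal lt1))) \*
  (fun w => r (tnth w (Ordinal lt2)))); last first.
  by apply/funext => w /=; rewrite !(tnth_nth 0).
apply: measurable_funM.
  exact: (measurableT_comp mf (measurable_tnth (Ordinal lt1))).
exact: (measurableT_comp (measurable_funP r) (measurable_tnth (Ordinal lt2))).
Qed.

Lemma opA_tuple_cons n (f : R -> R) (s t : R)
    (w : n.*2.-tuple (measurableTypeR R)) :
  @opA R r n.+1 f (tuple_cons (s, tuple_cons (t, w))) =
  f s * r t + @opA R r n f w.
Proof. by rewrite /opA big_ord_recl. Qed.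

(** Conditioning on the first pair [(s_1, t_1)]: the Bernoulli sign is averaged
    before any power is expanded, so that only nonnegative integrands occur. *)
Lemma ge0_integral_opA_recl n (f : R -> R) (G : R -> \bar R) :
  measurable_fun [set: measurableTypeR R] (f : measurableTypeR R -> R) ->
  measurable_fun [set: R] G ->
  (forall y, 0 <= G y)%E ->
  (\int[cube R n.+1.*2]_w G (@opA R r n.+1 f w) =
   \int[@unit_leb R]_s \int[cube R n.*2]_w
     (2^-1%:E * G (@opA R r n f w + f s)%R +
      2^-1%:E * G (@opA R r n f w - f s)%R))%E.
Proof.
move=> mf mG G0.
have mGA : measurable_fun [set: n.+1.*2.-tuple (measurableTypeR R)]
    (fun w => G (@opA R r n.+1 f w)).
  by apply: measurableT_comp => //; exact: measurable_opA.
rewrite (@ge0_integral_tuple_prob_recl _ _ _ (@unit_leb R) (n.*2).+1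
  (fun w => G (@opA R r n.+1 f w)))//.
apply: eq_integral => s _.
rewrite (@ge0_integral_tuple_prob_recl _ _ _ (@unit_leb R) n.*2
  (fun w => G (@opA R r n.+1 f (tuple_cons (s, w)))))//; last first.
  apply: (measurableT_comp mGA).
  apply: measurableT_comp; first exact: measurable_tuple_cons.
  exact: measurable_pair1.
under eq_integral do under eq_integral do rewrite opA_tuple_cons.
rewrite (@fubini_tonelli _ _ _ _ _ (@unit_leb R) (cube R n.*2)
  (fun tw => G (f s * r tw.1 + @opA R r n f tw.2)))//=; last first.
  apply: measurableT_comp => //; apply: measurable_funD.
    by apply: measurable_funM => //; apply: measurableT_comp.
  by apply: measurableT_comp => //; exact: measurable_opA.
apply: eq_integral => w _.
rewrite (@ge0_integral_centered_bernoulli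
  (fun y => G (f s * y + @opA R r n f w)))//.
  by rewrite mulr1 mulrN1 ![_ + @opA _ _ _ _ _]addrC.
by apply: measurableT_comp => //; apply: measurable_funD.
Qed.

(** Induction on [n]: the first term is split off, the expansion of the
    symmetrized power is integrated term by term, and [moment_bound_rec] sums
    the resulting bounds. *)
Lemma opA_even_moment (f : R -> R) (sg tau : R) :
  measurable_fun [set: measurableTypeR R] (f : measurableTypeR R -> R) ->
  1 <= sg -> tau <= sg ->
  (forall j, \int[@unit_leb R]_s (f s ^+ j.*2)%:E <=
    (2 ^+ j * (j.*2)`!%:R / (j`!%:R `^ tau))%:E)%E ->
  forall n m, (\int[cube R n.*2]_w (@opA R r n f w ^+ m.*2)%:E <=
    (moment_bound sg tau m n)%:E)%E.
Proof.
move=> mf sg1 tausg fj.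
have ev0 (x : R) k : 0 <= x ^+ k.*2 by exact: expr_double_ge0.
elim=> [|n IH] m.
  rewrite (eq_integral (cst ((0 : R) ^+ m.*2)%:E)); last first.
    by move=> w _; rewrite /opA big_ord0.
  rewrite integral_cst// [X in (_ * X)%E](_ : _ = 1%E); last first.
    exact: probability_setT.
  rewrite mule1 lee_fin.
  case: m => [|m]; last by rewrite doubleS expr0n/= moment_bound_ge0.
  by rewrite /moment_bound !expr0 fact0 !powR1 invr1 !mulr1.
rewrite (@ge0_integral_opA_recl n f (fun y => (y ^+ m.*2)%:E)) //; last 2 first.
- by apply: measurableT_comp => //; exact: exprn_measurable.
- by move=> y; rewrite lee_fin.
have mS k : measurable_fun [set: n.*2.-tuple (measurableTypeR R)]
    (fun w => (@opA R r n f w ^+ k)%:E).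
  apply: measurableT_comp => //; apply: measurable_funX.
  exact: measurable_opA.
have mfk k : measurable_fun [set: measurableTypeR R] (fun s => (f s ^+ k)%:E).
  by apply: measurableT_comp => //; exact: measurable_funX.
(* The coefficient of f(s)^(2j) once the inner integral has been bounded. *)
pose B j := 'C(m.*2, j.*2)%:R * moment_bound sg tau (m - j) n.
have B0 j : 0 <= B j by rewrite mulr_ge0 ?moment_bound_ge0.
apply: (@le_trans _ _ (\int[@unit_leb R]_s
    \sum_(j < m.+1) (B j)%:E * (f s ^+ j.*2)%:E)%E).
  apply: ge0_le_integral => //.
  - move=> s _; apply: integral_ge0 => w _.
    by rewrite adde_ge0// mule_ge0 ?lee_fin// invr_ge0.
  - apply: (@measurable_fun_fubini_tonelli_F _ _ _ _ _
      (cube R n.*2) (fun sw =>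
        2^-1%:E * ((@opA R r n f sw.2 + f sw.1) ^+ m.*2)%:E +
        2^-1%:E * ((@opA R r n f sw.2 - f sw.1) ^+ m.*2)%:E)%E) => /=.
      by apply: emeasurable_funD; apply: measurable_funeM;
        apply: measurableT_comp => //; apply: measurable_funX;
        [apply: measurable_funD | apply: measurable_funB];
        apply: measurableT_comp => //; exact: measurable_opA.
    by move=> sw; rewrite adde_ge0// mule_ge0 ?lee_fin// invr_ge0.
  - by apply: emeasurable_sum => j; exact: measurable_funeM.
  move=> s _.
  under eq_integral do rewrite -!EFinM -EFinD symmetrized_even_power -sumEFin.
  rewrite ge0_integral_sum//; last 2 first.
  - move=> j; apply: measurableT_comp => //; apply: measurable_funM => //.
    apply: measurable_funM => //; apply: measurable_funX.
    exact: measurable_opA.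
  - by move=> j w _; rewrite lee_fin !mulr_ge0.
  apply: lee_sum => j _.
  under eq_integral do rewrite mulrA EFinM.
  rewrite ge0_integralZl_EFin//; last 2 first.
  - by move=> w _; rewrite lee_fin.
  - by rewrite mulr_ge0.
  rewrite -EFinM /B mulrAC [in leRHS]EFinM.
  by apply: lee_wpmul2l; rewrite ?lee_fin ?mulr_ge0.
rewrite ge0_integral_sum//; last 2 first.
- by move=> j; exact: measurable_funeM.
- by move=> j s _; rewrite mule_ge0 ?lee_fin.
apply: le_trans (_ : (\sum_(j < m.+1) ('C(m.*2, j.*2)%:R *
    ((2 ^+ j * (j.*2)`!%:R / (j`!%:R `^ tau)) *
      moment_bound sg tau (m - j) n))%:E <= _)%E); last first.
  by rewrite sumEFin lee_fin moment_bound_rec.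
apply: lee_sum => j _.
rewrite ge0_integralZl_EFin//; last by move=> s _; rewrite lee_fin.
rewrite mulrCA mulrC -/(B j) [in leRHS]EFinM.
by apply: lee_wpmul2l; rewrite ?lee_fin.
Qed.

End bernoulli_sums.

(** * From Orlicz integrals to moments and back *)

Lemma measurable_orlicz_fun (R : realType) (p l : R) :
  measurable_fun [set: R] (fun y : R => (orlicz_fun p (`|y| / l))%:E).
Proof.
apply: measurableT_comp => //; apply: measurable_funB => //.
apply: measurableT_comp => //.
apply: (measurableT_comp (measurable_powR p)).
by apply: measurable_funM => //; apply: measurableT_comp.
Qed.

Lemma orlicz_fun_ge0 (R : realType) (p u : R) : 0 <= orlicz_fun p u.
Proof. by rewrite subr_ge0 -expR0 ler_expR powR_ge0. Qed.

Section orlicz_integral.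
Context d (T : measurableType d) (R : realType) (P : probability T R).
Implicit Types (p l : R) (g : T -> R).

Lemma probability_integral_cst (c : \bar R) :
  (\int[P]_x cst c x = c)%E.
Proof.
rewrite integral_cst// [X in (_ * X)%E](_ : _ = 1%E) ?mule1//.
exact: probability_setT.
Qed.

(** [u <= exp (u^p)] for [u >= 0], so the Orlicz integral dominates the first
    moment on a probability space. *)
Lemma orlicz_integrable p l g : 1 <= p -> 0 < l ->
  measurable_fun [set: T] g ->
  (\int[P]_x (orlicz_fun p (`|g x| / l))%:E <= 1)%E ->
  P.-integrable [set: T] (EFin \o g).
Proof.
move=> p1 l0 mg gl; have mo := measurableT_comp (measurable_orlicz_fun p l) mg.
apply/integrableP; split; first exact: measurableT_comp.
apply: (@le_lt_trans _ _ (\int[P]_x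
    (l%:E * ((orlicz_fun p (`|g x| / l))%:E + 1)))%E).
  apply: ge0_le_integral => //.
  - by apply: measurableT_comp => //; exact: measurableT_comp.
  - by apply: measurable_funeM; apply: emeasurable_funD.
  move=> x _ /=; rewrite -EFinD -EFinM lee_fin -ler_pdivrMl// mulrC subrK.
  set u := _ / _; have u0 : 0 <= u by rewrite divr_ge0// ltW.
  have [u1|/ltW u1] := leP u 1.
    by apply: le_trans u1 _; rewrite -expR0 ler_expR powR_ge0.
  apply: le_trans (le1r_powR u1 p1) _; apply: le_trans (expR_ge1Dx _).
  by rewrite lerDr.
rewrite ge0_integralZl_EFin ?ltW//; last 2 first.
- by move=> x _; rewrite adde_ge0 ?lee_fin ?orlicz_fun_ge0.
- by apply: emeasurable_funD.
rewrite ge0_integralD//; last by move=> x _; rewrite lee_fin orlicz_fun_ge0.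
rewrite probability_integral_cst.
apply: (@le_lt_trans _ _ (l%:E * (1 + 1))%E); last exact: ltry.
by apply: lee_wpmul2l; [rewrite lee_fin ltW | exact: leeD2r].
Qed.

(** [E exp (`|g|^p) <= 2], and [expr_le_expR_powR] bounds [g^(2j)] by
    [(2j)!^(1/p) exp (`|g|^p)]. The factor 2 is absorbed in [2^j] for [j > 0],
    while the moment of order 0 is exactly 1. *)
Lemma orlicz_even_moment p g j : 1 <= p -> measurable_fun [set: T] g ->
  (\int[P]_x (orlicz_fun p `|g x|)%:E <= 1)%E ->
  (\int[P]_x (g x ^+ j.*2)%:E <= (2 ^+ j * (j.*2)`!%:R `^ p^-1)%:E)%E.
Proof.
move=> p1 mg g1;
have mo : measurable_fun setT (fun x => (orlicz_fun p `|g x|)%:E).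
  have := measurableT_comp (measurable_orlicz_fun p 1) mg.
  by apply: eq_measurable_fun => x _ /=; rewrite divr1.
case: j => [|j].
  rewrite (eq_integral (cst 1%E)); last by move=> x _; rewrite expr0.
  by rewrite probability_integral_cst fact0 powR1 expr0 mulr1.
set c := _ `^ p^-1; have c0 : 0 <= c by exact: powR_ge0.
apply: (@le_trans _ _ (\int[P]_x
    (c%:E * ((orlicz_fun p `|g x|)%:E + 1)))%E).
  apply: ge0_le_integral => //.
  - by move=> x _; rewrite lee_fin expr_double_ge0.
  - by apply: measurableT_comp => //; exact: measurable_funX.
  - by apply: measurable_funeM; apply: emeasurable_funD.
  move=> x _; rewrite -EFinD -EFinM lee_fin subrK.
  apply: le_trans (expr_le_expR_powR j.+1.*2 p1 (normr_ge0 _)).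
  by rewrite -normrX ler_norm.
rewrite ge0_integralZl_EFin//; last 2 first.
- by move=> x _; rewrite adde_ge0 ?lee_fin ?orlicz_fun_ge0.
- by apply: emeasurable_funD.
rewrite ge0_integralD//; last by move=> x _; rewrite lee_fin orlicz_fun_ge0.
rewrite probability_integral_cst.
apply: (@le_trans _ _ (c%:E * (1 + 1))%E).
  by apply: lee_wpmul2l; [rewrite lee_fin | exact: leeD2r].
rewrite -EFinD -EFinM lee_fin mulrC ler_wpM2r// -mulr2n.
by rewrite exprS ler_peMr// exprn_ege1// ler1n.
Qed.

(** Integrating the series of [expR_powR_le_series] term by term gives
    [E exp (`|g|^p / p) <= 2 (1 + 1/2 + 1/4 + ...) = 4]; convexity
    ([orlicz_fun_scale]) brings the Orlicz integral down to 1. *)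
Lemma expR_moment_bound p g : 1 <= p -> measurable_fun [set: T] g ->
  (forall m, \int[P]_x (g x ^+ m.*2)%:E <=
     (2^-1 ^+ m * (m.*2)`!%:R `^ p^-1)%:E)%E ->
  (\int[P]_x (orlicz_fun p (`|g x| / (3 * p)))%:E <= 1)%E.
Proof.
move=> p1 mg gm;
have p0 : 0 < p by exact: lt_le_trans p1.
pose E x := expR (`|g x| `^ p / p).
have mE : measurable_fun setT E.
  apply: measurableT_comp => //; apply: measurable_funM => //.
  apply: (measurableT_comp (measurable_powR p)).
  exact: measurableT_comp.
have E1 x : 0 <= E x - 1.
  by rewrite subr_ge0 -expR0 ler_expR divr_ge0 ?powR_ge0// ltW.
have ev0 (x : R) k : 0 <= x ^+ k.*2 by exact: expr_double_ge0.
have mS k : measurable_fun setT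
    (fun x => (`|g x| ^+ k.*2 / (k.*2)`!%:R `^ p^-1)%:E).
  apply: measurableT_comp => //; apply: measurable_funM => //.
  by apply: measurable_funX; apply: measurableT_comp.
have S0 k x : (0 <= (`|g x| ^+ k.*2 / (k.*2)`!%:R `^ p^-1)%:E)%E.
  by rewrite lee_fin divr_ge0 ?powR_ge0.
have E4 : (\int[P]_x (E x)%:E <= 4%:E)%E.
  apply: (@le_trans _ _ (\int[P]_x (2%:E * \sum_(0 <= m <oo)
      (`|g x| ^+ m.*2 / (m.*2)`!%:R `^ p^-1)%:E))%E).
    apply: ge0_le_integral => //.
    - by move=> x _; rewrite lee_fin expR_ge0.
    - exact: measurableT_comp.
    - apply: measurable_funeM; apply: ge0_emeasurable_sum => //.
    by move=> x _; exact: expR_powR_le_series.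
  rewrite ge0_integralZl_EFin//; last 2 first.
  - by move=> x _; apply: nneseries_ge0.
  - exact: ge0_emeasurable_sum.
  rewrite integral_nneseries//.
  have -> : 4%:E = (2%:E * 2%:E)%E :> \bar R by rewrite -EFinM -natrM.
  apply: lee_wpmul2l; first by rewrite lee_fin.
  apply: (@le_trans _ _ (\sum_(0 <= m <oo) ((2^-1 : R) ^+ m)%:E)%E).
    apply: lee_nneseries => m _; first by move=> _; exact: integral_ge0.
    under eq_integral do rewrite mulrC EFinM.
    rewrite ge0_integralZl_EFin ?invr_ge0 ?powR_ge0//; last first.
      apply: measurableT_comp => //; apply: measurable_funX.
      exact: measurableT_comp.
    rewrite lee_pdivrMl ?powR_gt0 ?ltr0n ?fact_gt0// -EFinM mulrC.
    apply: le_trans (gm m); rewrite le_eqVlt; apply/orP; left; apply/eqP.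
    by apply: eq_integral => x _; rewrite -mul2n !exprM real_normK ?num_real.
  apply: lime_le.
    by apply: is_cvg_nneseries => m _ _; rewrite lee_fin exprn_ge0.
  apply: nearW => M; rewrite sumEFin lee_fin big_mkord.
  have -> : \sum_(i < M) (2^-1 : R) ^+ i = 2 * (1 - 2^-1 ^+ M).
    elim: M => [|M IH]; first by rewrite big_ord0 expr0 subrr mulr0.
    rewrite big_ord_recr/= IH exprS.
    by rewrite !mulrBr mulVKf// mulr1 mulr_natl mulr2n opprD addrA addrNK.
  by rewrite ger_pMr// gerBl exprn_ge0.
have E3 : (\int[P]_x (E x - 1)%:E <= 3%:E)%E.
  rewrite -(@leeD2rE _ 1%E)//.
  have -> : (3%:E + 1 = 4%:E :> \bar R)%E by rewrite -EFinD natr1.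
  apply: le_trans E4; rewrite -[X in (_ + X)%E](probability_integral_cst 1).
  rewrite -ge0_integralD//; last 2 first.
  - by move=> x _; rewrite lee_fin.
  - by apply: measurableT_comp => //; exact: measurable_funB.
  rewrite le_eqVlt; apply/orP; left; apply/eqP; apply: eq_integral => x _.
  by rewrite /cst -EFinD subrK.
apply: (@le_trans _ _ (\int[P]_x ((3^-1)%:E * (E x - 1)%:E))%E).
  apply: ge0_le_integral => //.
  - by move=> x _; rewrite lee_fin orlicz_fun_ge0.
  - exact: (measurableT_comp (measurable_orlicz_fun p (3 * p)) mg).
  - apply: measurable_funeM; apply: measurableT_comp => //.
    exact: measurable_funB.
  by move=> x _; rewrite -EFinM lee_fin orlicz_fun_scale.
rewrite ge0_integralZl_EFin//; last 2 first.
- by move=> x _; rewrite lee_fin.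
- by apply: measurableT_comp => //; exact: measurable_funB.
by rewrite lee_pdivrMl// mule1.
Qed.

End orlicz_integral.

(** * The operator norm on exp(L_p), finite p *)

Lemma integrable_rearrangement d (T : measurableType d) (R : realType)
    (P : probability T R) (f : T -> R) :
  P.-integrable [set: T] (EFin \o f) ->
  (@unit_leb R).-integrable [set: measurableTypeR R]
    (EFin \o rearrangement P f).
Proof.
move=> fi; have mf : measurable_fun [set: T] f.
  exact/measurable_EFinP/(measurable_int _ fi).
apply/integrableP; split.
  by apply: measurableT_comp => //; exact: measurable_rearrangement.
rewrite (@ge0_integral_rearrangement _ _ _ P f mf (fun y => `|y%:E|%E))//;
  last first.
  by apply: measurableT_comp => //; apply: measurableT_comp.
have /integrableP[_] := fi; apply: le_lt_trans.
rewrite le_eqVlt; apply/orP; left.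
by apply/eqP; apply: eq_integral => x _ /=; rewrite normr_id.
Qed.

Section operator_norm.
Context (R : realType) (r : {RV (@unit_leb R) >-> R}).
Hypothesis hr : centered_bernoulli r.

(** The moments of [S_n / (4 n^(sg/2))] are those of [S_n], at most
    [(8 n^sg)^m (2m)!^(1/p)], divided by [(16 n^sg)^m]: this leaves the ratio
    [1/2] required by [expR_moment_bound]. The constant [12 p] is [4 (3 p)]. *)
Lemma opA_orlicz_bound (p sg : R) (n : nat) (g : R -> R) :
  1 <= p -> 1 <= sg -> 2 * (1 - p^-1) <= sg -> (0 < n)%N ->
  measurable_fun [set: measurableTypeR R] (g : measurableTypeR R -> R) ->
  (\int[@unit_leb R]_s (orlicz_fun p `|g s|)%:E <= 1)%E ->
  (\int[cube R n.*2]_w (orlicz_fun p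
     (`|@opA R r n g w| / (12 * p * n%:R `^ (sg / 2))))%:E <= 1)%E.
Proof.
move=> p1 sg1 psg n0 mg g1; have p0 : 0 < p by exact: lt_le_trans p1.
have n1 : 0 < n%:R :> R by rewrite ltr0n.
have N0 : 0 < n%:R `^ (sg / 2) by exact: powR_gt0.
set N := n%:R `^ (sg / 2) in N0 *; have N4 : 0 < 4 * N by exact: mulr_gt0.
have N2 : N ^+ 2 = n%:R `^ sg.
  by rewrite /N -powR_mulrn ?powR_ge0// -powRrM divfK.
have mS : measurable_fun setT (fun w => @opA R r n g w / (4 * N)).
  by apply: measurable_funM => //; exact: measurable_opA.
have := @expR_moment_bound _ _ _ (cube R n.*2) p _ p1 mS.
have e w : `|@opA R r n g w / (4 * N)| / (3 * p) =
    `|@opA R r n g w| / (12 * p * N).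
  rewrite normrM normfV (gtr0_norm N4) -[LHS]mulrA -invfM.
  by congr (_ / _); rewrite mulrACA -natrM [N * p]mulrC mulrA.
under eq_integral do rewrite e.
apply => m.
have c0 : 0 < (16 * n%:R `^ sg) ^+ m.
  by rewrite exprn_gt0 ?mulr_gt0 ?powR_gt0.
have eS w : ((@opA R r n g w / (4 * N)) ^+ m.*2)%:E =
    (((16 * n%:R `^ sg) ^+ m)^-1%:E * (@opA R r n g w ^+ m.*2)%:E)%E.
  rewrite -EFinM mulrC exprMn; congr (_ * _)%:E.
  have -> : 16 * n%:R `^ sg = (4 * N) ^+ 2 by rewrite exprMn N2 -natrX.
  by rewrite exprVn -mul2n [in LHS]exprM.
under eq_integral do rewrite eS.
rewrite ge0_integralZl_EFin ?invr_ge0 ?(ltW c0)//; last 2 first.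
- by move=> w _; rewrite lee_fin expr_double_ge0.
- apply: measurableT_comp => //; apply: measurable_funX.
  exact: measurable_opA.
rewrite lee_pdivrMl// -EFinM.
apply: le_trans (opA_even_moment hr mg sg1 psg _ n m) _.
  move=> j; apply: le_trans (orlicz_even_moment j p1 mg g1) _.
  rewrite lee_fin -mulrA ler_wpM2l ?exprn_ge0//.
  by have /andP[] := fact_double_powR j p1.
rewrite lee_fin /moment_bound powRX// -[2 ^+ m * _ / _]mulrA.
have -> : (16 * n%:R `^ sg) ^+ m * (2^-1 ^+ m * (m.*2)`!%:R `^ p^-1) =
    2 ^+ m * (4 ^+ m * (m.*2)`!%:R `^ p^-1) * (n%:R `^ sg) ^+ m.
  have -> : 16 = 2 * 4 * 2 :> R by rewrite -!natrM.
  rewrite !exprMn.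
  have : 2 ^+ m * 2^-1 ^+ m = 1 :> R by rewrite -exprMn divff// expr1n.
  set a := (2 : R) ^+ m; set b := (2^-1 : R) ^+ m; set c := (4 : R) ^+ m.
  set x := _ ^+ m; set y := _ `^ p^-1 => ab.
  have -> : a * c * a * x * (b * y) = (a * b) * (a * (c * y) * x) by lra.
  by rewrite ab mul1r.
rewrite ler_wpM2r ?exprn_ge0 ?powR_ge0// ler_wpM2l ?exprn_ge0//.
by have /andP[] := fact_double_powR m p1.
Qed.

(** By homogeneity, a constant admissible for [f] becomes, after multiplication
    by the claimed bound, admissible for the rearrangement of [S_n]. *)
Lemma opA_norm_le (p sg : R) (n : nat) :
  1 <= p -> 1 <= sg -> 2 * (1 - p^-1) <= sg -> (0 < n)%N ->
  (opA_norm p%:E r n <= (12 * p * n%:R `^ (sg / 2))%:E)%E.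
Proof.
move=> p1 sg1 psg n0; have p0 : 0 < p by exact: lt_le_trans p1.
set M := 12 * p * _.
have M0 : 0 < M by rewrite !mulr_gt0 ?powR_gt0 ?ltr0n.
apply: ereal_inf_lbound; exists M; last by [].
split; first exact: ltW.
move=> f [fi fn].
have mf : measurable_fun [set: measurableTypeR R] (f : measurableTypeR R -> R).
  by move/integrableP: fi => [/measurable_EFinP].
have mS := @measurable_opA R r n f mf.
have key l : 0 < l ->
    (\int[@unit_leb R]_t (orlicz_fun p (`|f t| / l))%:E <= 1)%E ->
    (\int[cube R n.*2]_w (orlicz_fun p (`|@opA R r n f w| / (M * l)))%:E
      <= 1)%E.
  move=> l0 fl.
  have mg : measurable_fun [set: measurableTypeR R]
      ((fun s => f s / l) : measurableTypeR R -> R) by exact: measurable_funM.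
  have eg s : `|f s / l| = `|f s| / l by rewrite normrM normfV (gtr0_norm l0).
  have := @opA_orlicz_bound p sg n (fun s => f s / l) p1 sg1 psg n0 mg.
  under eq_integral do rewrite eg.
  move=> /(_ fl); apply: le_trans; rewrite le_eqVlt; apply/orP; left.
  apply/eqP/eq_integral => w _; do 2 congr (_ _).
  have -> : @opA R r n (fun s => f s / l) w = @opA R r n f w / l.
    by rewrite /opA mulr_suml; apply: eq_bigr => k _; rewrite mulrAC.
  by rewrite normrM normfV (gtr0_norm l0) invfM mulrA mulrAC.
have keyr l : 0 < l ->
    (\int[@unit_leb R]_t (orlicz_fun p (`|f t| / l))%:E <= 1)%E ->
    (expL_on_norm (cube R n.*2) p%:E (@opA R r n f) <= (M * l)%:E)%E.
  move=> l0 fl; apply: ereal_inf_lbound; exists (M * l); last by [].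
  split; first exact: mulr_gt0.
  rewrite (@ge0_integral_rearrangement _ _ _ (cube R n.*2) _ mS
     (fun y => (orlicz_fun p (`|y| / (M * l)))%:E)).
  - by under eq_integral do rewrite normr_id; exact: key.
  - exact: measurable_orlicz_fun.
  - by move=> y; rewrite lee_fin orlicz_fun_ge0.
have [_ [l [l0 fl] <-] _] := ereal_inf_lt fn.
have Si : (cube R n.*2).-integrable setT (EFin \o @opA R r n f).
  exact: (orlicz_integrable p1 (mulr_gt0 M0 l0) mS (key l l0 fl)).
split; last first.
  rewrite -lee_pdivrMl//; apply: le_ereal_inf_tmp => _ [k [k0 fk] <-].
  by rewrite lee_pdivrMl// -EFinM keyr.
split; first exact: Si.
split; first exact: integrable_rearrangement Si.
exact: le_lt_trans (keyr l l0 fl) (ltry _).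
Qed.

(** * The operator norm on the bounded functions *)

(** The box on which every [f(s_k)] is at most [a] in absolute value and every
    [r(t_k)] is a sign is a product of sets of measure 1. *)
Lemma opA_bounded (n : nat) (f : R -> R) (a : R) :
  measurable_fun [set: measurableTypeR R] (f : measurableTypeR R -> R) ->
  unit_leb [set s | `|f s| <= a] = 1%E ->
  cube R n.*2 [set w | a *+ n < `|@opA R r n f w|] = 0%E.
Proof.
move=> mf fa1.
pose S1 : set (measurableTypeR R) := r @^-1` [set 1] `|` r @^-1` [set (-1)].
pose Sa : set (measurableTypeR R) := [set s | `|f s| <= a].
(* Even positions carry the s_k and odd positions the t_k. *)
pose A (i : 'I_n.*2) := if odd i then S1 else Sa.
have mS1 : measurable S1.
  by apply: measurableU; rewrite -[_ @^-1` _]setTI; exact: measurable_funP.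
have mSa : measurable Sa.
  exact: measurable_normr_le.
have mA i : measurable (A i) by rewrite /A; case: ifP.
pose box :=
  [set w : n.*2.-tuple (measurableTypeR R) | forall i, A i (tnth w i)].
have box1 : cube R n.*2 box = 1%E.
  rewrite /cube tuple_prob_box// big1// => i _; rewrite /A; case: ifP => // _.
  exact: centered_bernoulli_support.
have mbox : measurable box.
  rewrite (_ : box = \bigcap_(i in [set: 'I_n.*2])
      ((fun w : n.*2.-tuple (measurableTypeR R) => tnth w i) @^-1` A i)).
    apply: fin_bigcap_measurable => // i _.
    by rewrite -[_ @^-1` _]setTI; exact: measurable_tnth.
  by apply/seteqP; split=> w wB i; [move=> _|]; exact: wB.
have mE : measurable [set w | a *+ n < `|@opA R r n f w|].
  by apply: measurable_normr_gt; exact: measurable_opA.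
apply/eqP; rewrite eq_le measure_ge0 andbT.
apply: (@le_trans _ _ (cube R n.*2 (~` box))); last first.
  rewrite (_ : cube R n.*2 (~` box) = (1 - cube R n.*2 box)%E).
    by rewrite box1 subee.
  exact: probability_setC.
apply: le_measure; rewrite ?inE//; first exact: measurableC.
move=> w /= Sw boxw; move: Sw; apply/negP; rewrite -leNgt.
apply: le_trans (ler_norm_sum _ _ _) _.
rewrite -[in leRHS](card_ord n) -sumr_const; apply: ler_sum => k _.
have lt1 : (k.*2 < n.*2)%N by rewrite ltn_double.
have lt2 : (k.*2.+1 < n.*2)%N by rewrite ltn_Sdouble.
have := boxw (Ordinal lt1); rewrite /A/= odd_double (tnth_nth 0)/= => fk.
have := boxw (Ordinal lt2); rewrite /A/= odd_double (tnth_nth 0)/= => rk.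
by rewrite normrM; case: rk => ->; rewrite ?normrN1 ?normr1 mulr1.
Qed.

Lemma expL_norm_pinfty (x : R -> R) :
  expL_norm +oo%E x = ess_sup (@unit_leb R) (abse \o (EFin \o x)).
Proof.
rewrite /expL_norm unlock ifT//.
by rewrite [X in (_ < X)%E](_ : _ = 1%E) ?lte01//; exact: unit_leb_setT.
Qed.

Lemma opA_norm_pinfty (n : nat) : (opA_norm +oo%E r n <= n%:R%:E)%E.
Proof.
apply: ereal_inf_lbound; exists n%:R; last by [].
split; first exact: ler0n.
move=> f [fi fn].
have mf : measurable_fun [set: measurableTypeR R] (f : measurableTypeR R -> R).
  by move/integrableP: fi => [/measurable_EFinP].
have mS := @measurable_opA R r n f mf.
have [a a0 eN] : exists2 a, 0 <= a & expL_norm +oo%E f = a%:E.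
  have N0 : (0 <= expL_norm +oo%E f)%E by exact: Lnorm_ge0.
  exists (fine (expL_norm +oo%E f)); first exact: fine_ge0.
  by rewrite fineK// ge0_fin_numE.
pose D : set (measurableTypeR R) := [set s | `|f s| <= a].
have mD : measurable D by exact: measurable_normr_le.
have D1 : unit_leb D = 1%E.
  have /ess_supP [N [mN N0 sN]] :
      (ess_sup (@unit_leb R) (abse \o (EFin \o f)) <= a%:E)%E.
    by rewrite -expL_norm_pinfty eN.
  apply/eqP; rewrite eq_le; apply/andP; split.
    exact: probability_le1.
  have <- : unit_leb (~` N) = 1%E.
    transitivity (1 - unit_leb N)%E; first exact: probability_setC.
    by rewrite N0 sube0.
  apply: le_measure; rewrite ?inE//; first exact: measurableC.
  move=> s /= Ns; rewrite /D/= leNgt; apply/negP => fs; apply/Ns/sN => /=.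
  by rewrite lee_fin leNgt fs.
have S0 := opA_bounded n mf D1.
have Si : (cube R n.*2).-integrable setT (EFin \o @opA R r n f).
  apply/integrableP; split; first exact: measurableT_comp.
  apply: (@le_lt_trans _ _ (\int[cube R n.*2]_w cst (a *+ n)%:E w)%E);
    last first.
    by rewrite probability_integral_cst ltry.
  apply: ae_ge0_le_integral => //.
  - by apply: measurableT_comp => //; exact: measurableT_comp.
  - by move=> w _; rewrite lee_fin mulrn_wge0.
  exists [set w | a *+ n < `|@opA R r n f w|]; split => //.
    exact: measurable_normr_gt.
  move=> w /= h; rewrite ltNge; apply/negP => Sw.
  by apply: h => _; rewrite lee_fin.
have Sn : (expL_on_norm (cube R n.*2) +oo (@opA R r n f) <= n%:R%:E * a%:E)%E.
  rewrite /expL_on_norm expL_norm_pinfty; apply/ess_supP.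
  exists (rearrangement (cube R n.*2) (@opA R r n f) @^-1` `]a *+ n, +oo[).
  split.
  - rewrite -[_ @^-1` _]setTI; exact: measurable_rearrangement.
  - transitivity
      (cube R n.*2 ((Num.norm \o @opA R r n f) @^-1` `]a *+ n, +oo[)).
      exact: unit_leb_rearrangement_ray.
    rewrite -S0; congr (cube R n.*2 _).
    by apply/seteqP; split=> x /=; rewrite in_itv/= andbT.
  - move=> t /= h; rewrite in_itv/= andbT ltNge; apply/negP => St; apply: h.
    by rewrite ger0_norm ?rearrangement_ge0// -EFinM lee_fin mulr_natl.
split; last by rewrite eN.
split; first exact: Si.
split; first exact: integrable_rearrangement Si.
by apply: le_lt_trans Sn _; rewrite -EFinM ltry.
Qed.

End operator_norm.

Theorem theorem16 (R : realType) (r : {RV (@unit_leb R) >-> R})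
    (hr : centered_bernoulli r) :
  (forall p : R, 1 <= p <= 2 ->
     exists2 C : R, 0 < C &
       forall n : nat, (1 <= n)%N ->
         (opA_norm p%:E r n <= (C * Num.sqrt n%:R)%:E)%E)
  /\
  (forall p : \bar R, (2%:E <= p)%E ->
     exists2 C : R, 0 < C &
       forall n : nat, (1 <= n)%N ->
         (opA_norm p r n <= (C * n%:R `^ (1 - fine p^-1%E))%:E)%E).
Proof.
split=> [p /andP[p1 p2]|[p|_|]].
- have p0 : 0 < p by exact: lt_le_trans p1.
  exists (12 * p) => [|n n0]; first exact: mulr_gt0.
  (* p <= 2 means 2 (1 - 1/p) <= 1: the exponent sg = 1 is admissible. *)
  rewrite -powR12_sqrt// -div1r; apply: opA_norm_le => //.
  have : 2^-1 <= p^-1 by rewrite lef_pV2 ?posrE.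
  have : 2 * 2^-1 = 1 :> R by rewrite divff.
  by move: (2^-1) (p^-1) => x y; lra.
- rewrite lee_fin => p2.
  have p0 : 0 < p by exact: lt_le_trans p2.
  exists (12 * p) => [|n n0]; first exact: mulr_gt0.
  rewrite inver gt_eqF//=.
  (* p >= 2 means 2 (1 - 1/p) >= 1, so it can itself be taken for sg. *)
  have -> : 1 - p^-1 = (2 * (1 - p^-1)) / 2 by rewrite mulrAC divff ?mul1r.
  apply: opA_norm_le => //; first by rewrite (le_trans _ p2)// ler1n.
  have : p^-1 <= 2^-1 by rewrite lef_pV2 ?posrE.
  have : 2 * 2^-1 = 1 :> R by rewrite divff.
  by move: (2^-1) (p^-1) => x y; lra.
- exists 1 => // n _.
  by rewrite invey/= subr0 powRr1// mul1r opA_norm_pinfty.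
- by [].
Qed.
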